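(* For all integers $l,m\ge 1$, $$2l\,s(1+m,1+l)=\frac{m+1}{l+m-1}\sum_{n=1}^{l}\sum_{k=0}^{m-1}\binom{l+m-2}{n+k-1}^{-1}\binom{m}{k}\binom{m}{1+k}\,s(1+k,n)\,s(m-k,l+1-n),$$ where $s(\cdot,\cdot)$ denotes the signed Stirling numbers of the first kind.
   Context: The signed Stirling numbers of the first kind $s(n,k)$ are defined by $x^{(n)}=\sum_{k=0}^{n}(-1)^{n-k}s(n,k)x^k$, where $x^{(n)}=\prod_{i=0}^{n-1}(x+i)$ is the rising factorial; $s(n,k)=0$ for $k>n$. Here $\binom{\cdot}{\cdot}^{-1}$ denotes the reciprocal of the binomial coefficient. *)

(* Defs.v *)
From HB Require Import structures.
From mathcomp Require Import all_boot all_order all_algebra.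

Set Implicit Arguments.
Unset Strict Implicit.
Unset Printing Implicit Defensive.

Import Order.TTheory GRing.Theory Num.Theory.
Local Open Scope ring_scope.

Definition rising_factorial (n : nat) : {poly int} :=
  \prod_(i < n) ('X + (i%:R)%:P).

(* The defining expansion solved for s(n,k); for k > n the truncated n - k is
   harmless since the coefficient is 0 (see stirling1_expansion and
   stirling1_gt below, which characterize s). *)
Definition stirling1 (n k : nat) : int :=
  (-1) ^+ (n - k) * (rising_factorial n)`_k.

Lemma size_rising_factorial n : size (rising_factorial n) = n.+1.
Proof.
rewrite /rising_factorial.
under eq_bigr => i _ do rewrite -[i%:R]opprK polyCN.
by rewrite size_prod_XsubC [index_enum _]unlock -enumT size_enum_ord.
Qed.

Lemma stirling1_expansion n :
  rising_factorial n
  = \sum_(0 <= k < n.+1) ((-1) ^+ (n - k) * stirling1 n k) *: 'X^k.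
Proof.
rewrite big_mkord -[LHS]coefK size_rising_factorial poly_def.
by apply: eq_bigr => k _; rewrite /stirling1 signrMK.
Qed.

Lemma stirling1_gt n k : (n < k)%N -> stirling1 n k = 0.
Proof.
by move=> nk; rewrite /stirling1 nth_default ?mulr0 // size_rising_factorial.
Qed.

(* Main.v *)
Require Import Defs.
From HB Require Import structures.
From mathcomp Require Import all_boot all_order all_algebra.
From mathcomp Require Import ring zify.

(** Put [R_n = (X+1)...(X+n)], [T_0 = 1] and
    [T_(n+1) = X (1 - yD)^-(n+1) R_n] with [y] formal.  The commutation of [X]
    with [D] and with the shift gives [Q T_n = n T_(n-1)] for the delta operator
    [Q = (1 - yD)(1 - e^-D)], so [T] is a sequence of binomial type.  Only the
    part of [T_n(X + w) = \sum_k 'C(n,k) T_k(X) T_(n-k)(w)] linear in [w] is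
    needed: [T_n' = \sum_(k < n) 'C(n,k) T_(n-k)'(0) T_k].  Its coefficient of
    [X y^(l-1)] at [n = m + 1] is the convolution identity, because the
    coefficients of [T_n] in [X] and [y] are Stirling numbers times factorials. *)

Import Order.TTheory GRing.Theory Num.Theory.
Local Open Scope ring_scope.

Section BinomialType.

Set Implicit Arguments.
Unset Strict Implicit.

(** * The operator [(1 - yD)^-n] and its commutation rules *)

Variables (K : idomainType) (y : K).

(* [(1 - yD)^-n]; for [n = 0] the truncated subtraction gives the identity. *)
Definition geom_diff (n : nat) (p : {poly K}) : {poly K} :=
  \sum_(i < size p) ('C(n + i - 1, i)%:R * y ^+ i) *: p^`(i).

(** Derivatives of order at least [size p] vanish, so polynomials of different sizes can share one
    summation range. *)
Lemma geom_diffE n N (p : {poly K}) : (size p <= N)%N ->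
  geom_diff n p = \sum_(i < N) ('C(n + i - 1, i)%:R * y ^+ i) *: p^`(i).
Proof.
move=> pN; rewrite /geom_diff (big_ord_widen _ (fun i =>
  ('C(n + i - 1, i)%:R * y ^+ i) *: p^`(i)) pN) big_mkcond /=.
apply: eq_bigr => i _; case: ltnP => // pi.
by rewrite (derivn_poly0 pi) scaler0.
Qed.

Lemma geom_diff1 n : geom_diff n 1 = 1.
Proof. by rewrite /geom_diff size_poly1 big_ord1 bin0 mulr1 scale1r. Qed.

Fact geom_diff_is_linear n : linear (geom_diff n).
Proof.
move=> a p q; pose N := maxn (size (a *: p + q)) (maxn (size p) (size q)).
rewrite !(@geom_diffE n N) /N ?leq_max ?leqnn ?orbT // scaler_sumr -big_split /=.
apply: eq_bigr => i _.
by rewrite derivnD derivnZ scalerDr !scalerA [a * _]mulrC.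
Qed.

HB.instance Definition _ n := GRing.isLinear.Build K {poly K} {poly K} _
  (geom_diff n) (geom_diff_is_linear n).

Lemma geom_diff_comp_XsubC n (p : {poly K}) c :
  geom_diff n (p \Po ('X - c%:P)) = geom_diff n p \Po ('X - c%:P).
Proof.
rewrite /geom_diff size_comp_poly2 ?size_XsubC // linear_sum /=.
apply: eq_bigr => i _; rewrite comp_polyZ; congr (_ *: _).
elim: (nat_of_ord i) => // j IH.
by rewrite !derivnS IH deriv_comp derivXsubC mulr1.
Qed.

(** Pascal's rule for the coefficients of [(1 - t)^-(n+1)]: one factor [1 - yD] cancels. *)
Lemma geom_diffS n (p : {poly K}) :
  geom_diff n.+1 p - y *: (geom_diff n.+1 p)^`() = geom_diff n p.
Proof.
(* One extra term in the undifferentiated sums: once index 0 is split off, they match the sum that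
   [D] has shifted. *)
have pN := leqnSn (size p).
rewrite {1}(geom_diffE n.+1 pN) (geom_diffE n pN).
rewrite /geom_diff (linear_sum deriv) scaler_sumr big_ord_recl [RHS]big_ord_recl -addrA; congr (_ + _).
  by rewrite !bin0.
rewrite -sumrB; apply: eq_bigr => i _ /=.
rewrite derivZ scalerA -derivnS -scalerBl; congr (_ *: _).
rewrite /bump /= !add1n !addnS !addSn !subSS !subn0 binS natrD exprS.
ring.
Qed.

Lemma derivnXM (p : {poly K}) i :
  ('X * p)^`(i) = 'X * p^`(i) + p^`(i.-1) *+ i.
Proof.
elim: i => [|i IH]; first by rewrite addr0.
rewrite derivnS IH derivD derivM derivX mul1r -derivnS derivMn.
case: i {IH} => [|i] /=; first by rewrite addr0 addrC.
by rewrite -derivnS [in RHS]mulrS [RHS]addrCA addrA.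
Qed.

(** The commutator of [f(D)] with multiplication by [X] is [f'(D)]; here [f(t) = (1 - yt)^-n] and
    [f'(t) = ny (1 - yt)^-(n+1)]. *)
Lemma geom_diffXM n (p : {poly K}) :
  geom_diff n ('X * p) = 'X * geom_diff n p + (n%:R * y) *: geom_diff n.+1 p.
Proof.
have Xp : (size ('X * p)%R <= (size p).+1)%N.
  by rewrite (leq_trans (size_polyMleq _ _)) // size_polyX.
rewrite (geom_diffE n Xp) (geom_diffE n (leqnSn _)).
rewrite mulr_sumr scaler_sumr.
under eq_bigr do rewrite derivnXM scalerDr.
rewrite big_split /=; congr (_ + _).
  by apply: eq_bigr => i _; rewrite scalerAr.
rewrite big_ord_recl /= mulr0n scaler0 add0r.
apply: eq_bigr => i _ /=; rewrite /bump add1n -scaler_nat !scalerA /=.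
congr (_ *: _).
have E : ('C(n + i.+1 - 1, i.+1) * i.+1 = n * 'C(n.+1 + i - 1, i))%N.
  rewrite addSn subSS subn0 addnS subSS subn0.
  case: n Xp => [|n] _; first by rewrite add0n bin_small.
  rewrite mulnC mul_bin_left; congr (_ * _)%N; lia.
have := congr1 (fun j => j%:R : K) E; rewrite !natrM exprS => {}E.
rewrite mulrAC E; ring.
Qed.

(** * The polynomials [T_n] ([binom_seq]) and the delta operator [Q] *)

Definition shifted_rising (n : nat) : {poly K} :=
  \prod_(i < n) ('X + (i.+1%:R)%:P).

Lemma shifted_risingS_comp n :
  shifted_rising n.+1 \Po ('X - 1%:P) = 'X * shifted_rising n.
Proof.
rewrite /shifted_rising rmorph_prod big_ord_recl /=; congr (_ * _).
  by rewrite comp_polyD comp_polyX comp_polyC subrK.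
apply: eq_bigr => i _.
rewrite comp_polyD comp_polyX comp_polyC /bump add1n -addn1 natrD polyCD.
ring.
Qed.

Definition binom_seq (n : nat) : {poly K} :=
  if n is n'.+1 then 'X * geom_diff n (shifted_rising n') else 1.
Arguments binom_seq : simpl never.

(* [(1 - yD)(1 - e^-D)] *)
Definition delta_op (p : {poly K}) : {poly K} :=
  let q := p - (p \Po ('X - 1%:P)) in q - y *: q^`().

Fact delta_op_is_linear : linear delta_op.
Proof.
move=> a p q; rewrite /delta_op /= comp_polyD comp_polyZ.
rewrite !(derivN, derivD, derivZ) -!mul_polyC; ring.
Qed.

HB.instance Definition _ := GRing.isLinear.Build K {poly K} {poly K} _
  delta_op delta_op_is_linear.

Lemma delta_op_deriv p : delta_op p^`() = (delta_op p)^`().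
Proof.
by rewrite /delta_op !(derivB, derivZ, deriv_comp, derivX, derivC, subr0, mulr1).
Qed.

(** Moving [1 - yD] past [X], and [X] out of [(1 - yD)^-(n+1)], produces two opposite multiples of
    [yA]; what is left is a multiple of [XC], with [A] and [C] as set below. *)
Lemma delta_op_binom_seq n : delta_op (binom_seq n.+1) = n.+1%:R *: binom_seq n.
Proof.
case: n => [|n].
  rewrite /binom_seq /shifted_rising big_ord0 geom_diff1 mulr1 /delta_op comp_polyX.
  by rewrite subKr derivC scaler0 subr0 scale1r.
rewrite /binom_seq /delta_op.
set R := shifted_rising n.
have RS : shifted_rising n.+1 = n.+1%:R *: R + 'X * R.
  by rewrite /R /shifted_rising big_ord_recr /= mulrC mulrDl mul_polyC addrC.
have shiftR : (n.+1%:R *: R + 'X * R) \Po ('X - 1%:P) = 'X * R.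
  by rewrite -RS shifted_risingS_comp.
rewrite RS comp_polyM comp_polyX -geom_diff_comp_XsubC shiftR linearD linearZ /=.
have W1 := geom_diffS n.+1 R; have W2 := geom_diffS n.+1 ('X * R).
have W3 := geom_diffXM n.+1 R.
set A := geom_diff n.+2 R in W1 W3 *; set B := geom_diff n.+2 ('X * R) in W2 *.
set C := geom_diff n.+1 R in W1 W3 *.
(* Backward difference of [T_(n+2)]; its shift is [(X - 1)B] because [R_(n+1)(X - 1) = X R_n]. *)
have -> : 'X * (n.+1%:R *: A + B) - ('X - 1%:P) * B = n.+1%:R *: ('X * A) + B.
  by rewrite -!mul_polyC; ring.
rewrite derivD derivZ derivM derivX mul1r.
have -> : n.+1%:R *: ('X * A) + B - y *: (n.+1%:R *: (A + 'X * A^`()) + B^`()) =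
   n.+1%:R *: ('X * (A - y *: A^`()) - y *: A) + (B - y *: B^`()).
  by rewrite -!mul_polyC; ring.
rewrite W1 W2 W3 -[n.+2]addn1 natrD -!mul_polyC polyCM polyCD.
ring.
Qed.

(** * The kernel of [Q] and the derivative of [T_n] *)

Hypothesis pcharK : [pchar K] =i pred0.

(** By degree, [q = y q'] forces [q = 0]. Then [p] has period 1, and [p - p(0)] vanishes at all
    natural numbers, which are distinct in characteristic 0. *)
Lemma delta_op_eq0 p : delta_op p = 0 -> p = (p.[0])%:P.
Proof.
move=> /eqP; rewrite /delta_op /= subr_eq0; set q := p - _ => /eqP qE.
have q0 : q = 0.
  apply/eqP; apply/negPn/negP => qn0; have := lt_size_deriv qn0.
  by rewrite ltnNge [in X in (X <= _)%N]qE size_scale_leq.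
have step x : p.[x - 1] = p.[x].
  have /(congr1 (fun r => r.[x])) := q0.
  rewrite /q !hornerE horner_comp !hornerE => /eqP.
  by rewrite subr_eq0 => /eqP.
have pn n : p.[n%:R] = p.[0].
  by elim: n => // n <-; rewrite -[in LHS]step -addn1 natrD addrK.
apply/eqP; rewrite -subr_eq0; set r := p - _.
apply/negPn/negP => rn0.
pose s : seq K := [seq n%:R | n <- iota 0 (size r)].
have : (size s < size r)%N.
  apply: max_poly_roots rn0 _ _.
    by apply/allP => _ /mapP[n _ ->]; rewrite rootE !hornerE pn subrr.
  rewrite map_inj_uniq ?iota_uniq //.
  have inj n k : (n <= k)%N -> n%:R = k%:R :> K -> n = k.
    move=> nk /eqP; rewrite eq_sym -subr_eq0 -natrB // ((pcharf0P K).1 pcharK).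
    by rewrite subn_eq0 => kn; apply/eqP; rewrite eqn_leq nk.
  by move=> n k; case: (leqP n k) => [/inj//|/ltnW/inj nk /esym /nk].
by rewrite size_map size_iota ltnn.
Qed.

Lemma binom_seq0 n : (binom_seq n).[0] = (n == 0%N)%:R.
Proof. by case: n => [|n]; rewrite /binom_seq !hornerE. Qed.

(** By induction [Q], which commutes with [D], kills the difference of the two sides; so the
    difference is constant, and it is 0 at 0. *)
Lemma deriv_binom_seq n :
  (binom_seq n)^`() =
  \sum_(k < n) ('C(n, k)%:R * (binom_seq (n - k))`_1) *: binom_seq k.
Proof.
elim: n => [|n IH]; first by rewrite big_ord0 derivC.
apply/eqP; rewrite -subr_eq0; set F := _ - _; apply/eqP.
(* Only [T_0] is nonzero at 0, and its coefficient in the sum is [T_(n+1)'(0)]. *)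
have F0 : F.[0] = 0.
  rewrite /F hornerD hornerN horner_sum big_ord_recl big1 => [|i _]; last first.
    by rewrite hornerZ binom_seq0 mulr0.
  rewrite hornerZ binom_seq0 bin0 !mul1r mulr1 addr0 subn0.
  by rewrite horner_coef0 coef_deriv mulr1n subrr.
rewrite [F]delta_op_eq0 ?F0 //.
rewrite /F linearB /= delta_op_deriv delta_op_binom_seq derivZ IH.
(* [Q] kills the constant term [k = 0]; the others match the induction hypothesis by absorption,
   [(n+1) 'C(n, i) = (i+1) 'C(n+1, i+1)]. *)
rewrite (linear_sum delta_op) big_ord_recl linearZ /=.
rewrite {1}/delta_op comp_polyC subrr derivC scaler0 subr0 scaler0 add0r.
rewrite scaler_sumr -sumrB big1 // => i _.
rewrite /bump add1n [delta_op _]linearZ /= delta_op_binom_seq !scalerA subSS.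
rewrite -scalerBl mulrA [_ * i.+1%:R]mulrAC -!natrM.
by rewrite (mul_bin_diag n.+1 i) mulnC subrr scale0r.
Qed.

(** Coefficient of [X] in the derivative formula, to which [T_0 = 1] contributes nothing. The 2 of
    the final identity comes from differentiating [X^2]. *)
Lemma binom_seq_coef2 n :
  (binom_seq n.+2)`_2 *+ 2 =
  \sum_(k < n.+1) 'C(n.+2, k.+1)%:R * (binom_seq k.+1)`_1
                  * (binom_seq (n - k).+1)`_1.
Proof.
rewrite -coef_deriv deriv_binom_seq coef_sum big_ord_recl coefZ coefC mulr0 add0r.
apply: eq_bigr => i _; rewrite coefZ lift0 subSS.
have le_in : (i <= n)%N by rewrite -ltnS.
by rewrite (subSn le_in) mulrAC.
Qed.

Lemma binom_seq_coefS n j :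
  (binom_seq n.+1)`_j.+1 =
  \sum_(i < n.+1) ('C(n + i, i) * (i + j) ^_ i)%:R * y ^+ i
                  * (shifted_rising n)`_(i + j).
Proof.
have sz : (size (shifted_rising n) <= n.+1)%N.
  rewrite /shifted_rising.
  under eq_bigr => i _ do rewrite -[i.+1%:R]opprK polyCN.
  by rewrite size_prod_XsubC [index_enum _]unlock -enumT size_enum_ord.
rewrite /binom_seq coefXM /= (geom_diffE _ sz) coef_sum; apply: eq_bigr => i _.
by rewrite coefZ coef_derivn -mulr_natr natrM addSn subSS subn0; ring.
Qed.

End BinomialType.

(** * Coefficients of [T_n] in [X] and [y] *)

Lemma coef_shifted_rising (K : idomainType) n j :
  (shifted_rising K n)`_j = ((rising_factorial n.+1)`_j.+1)%:~R.
Proof.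
have -> : rising_factorial n.+1 = 'X * shifted_rising int n.
  by rewrite /rising_factorial big_ord_recl addr0.
have -> : shifted_rising K n = map_poly intr (shifted_rising int n).
  rewrite rmorph_prod /=; apply: eq_bigr => i _.
  by rewrite rmorphD /= map_polyX map_polyC /= [_%:~R]rmorph_nat.
by rewrite coef_map coefXM.
Qed.

(** Replaces the truncated [n - k] by an exponent of the same parity, so that signs multiply
    freely. *)
Lemma stirling1E n k : stirling1 n k = (-1) ^+ (n + k) * (rising_factorial n)`_k.
Proof.
case: (leqP k n) => kn; last first.
  by rewrite stirling1_gt // nth_default ?mulr0 // size_rising_factorial.
rewrite /stirling1; congr (_ * _).
by rewrite -[LHS]signr_odd -[RHS]signr_odd oddB // oddD.
Qed.

Lemma binom_seq_coefS_coef n j i :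
  (binom_seq ('X : {poly rat}) n.+1)`_j.+1`_i =
  ('C(n + i, i) * (i + j) ^_ i)%:R * ((rising_factorial n.+1)`_(i + j).+1)%:~R.
Proof.
rewrite binom_seq_coefS coef_sum.
under eq_bigr => h _ do rewrite coef_shifted_rising mulrAC -polyC_natr
  -[_%:~R](rmorph_int polyC) -polyCM coefCM coefXn.
(* Only the summand of index [i] carries [y^i]; for [i > n] both sides are 0. *)
case: (ltnP i n.+1) => ni.
  rewrite (bigD1 (Ordinal ni)) //= eqxx mulr1 big1 ?addr0 // => h hi.
  by rewrite eq_sym (negbTE (hi : (h != i :> nat))) mulr0.
rewrite big1 => [|h _]; last by rewrite gtn_eqF ?mulr0 // (leq_trans _ ni).
by rewrite [_`_(i + j).+1]nth_default ?mulr0 // size_rising_factorial; lia.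
Qed.

(** Coefficient of [y^L] in [binom_seq_coef2], taken over [{poly rat}] with [y] the indeterminate;
    the sum over [i] is the product of polynomials in [y]. *)
Lemma rising_factorial_convolution M L :
  ('C(M.+1 + L, L) * L.+1`!)%:R * ((rising_factorial M.+2)`_L.+2)%:~R *+ 2 =
  \sum_(i < L.+1) \sum_(k < M.+1)
    'C(M.+2, k.+1)%:R *
    (('C(k + i, i) * i`!)%:R * ((rising_factorial k.+1)`_i.+1)%:~R) *
    (('C(M - k + (L - i), L - i) * (L - i)`!)%:R *
     ((rising_factorial (M - k).+1)`_(L - i).+1)%:~R) :> rat.
Proof.
have pchar0 : [pchar {poly rat}] =i pred0.
  apply/pcharf0P => n.
  by rewrite -polyC_natr polyC_eq0 pnatr_eq0.
have /(congr1 (fun p : {poly rat} => p`_L)) := binom_seq_coef2 'X pchar0 M.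
have fact1 : (L.+1 ^_ L = L.+1`!)%N.
  by rewrite -(ffact_fact (leqnSn L)) subSnn muln1.
rewrite coefMn binom_seq_coefS_coef addn1 fact1 => ->.
rewrite exchange_big coef_sum; apply: eq_bigr => k _.
rewrite -mulrA -polyC_natr coefCM coefM mulr_sumr; apply: eq_bigr => i _.
by rewrite !binom_seq_coefS_coef !addn0 !ffactnn mulrA.
Qed.

(** * Factorial weights and the final identity *)

Lemma natr_bin (x z : nat) :
  'C(x + z, z)%:R = (x + z)`!%:R / (x`!%:R * z`!%:R) :> rat.
Proof.
have /(congr1 (fun j => j%:R : rat)) := bin_fact (leq_addl x z).
rewrite addnK !natrM => <-; field.
by rewrite !pnatr_eq0 -!lt0n !fact_gt0.
Qed.

(** With [a = m - 1 - k] and [b = l - 1 - i] no subtraction occurs. In factorials, the denominator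
    [l + m - 1] and the inverse binomial form [1/(l + m - 1)!], which the last factor on the left
    cancels. *)
Lemma binomial_weights (k i a b : nat) :
  ((k + a).+2%:R / (i + b + (k + a)).+1%:R) *
  ('C(i + b + (k + a), i + k)%:R^-1 * 'C((k + a).+1, k)%:R
   * 'C((k + a).+1, k.+1)%:R) * ('C((k + a).+1 + (i + b), i + b) * (i + b)`!)%:R =
  'C((k + a).+2, k.+1)%:R * ('C(k + i, i) * i`!)%:R * ('C(a + b, b) * b`!)%:R
  :> rat.
Proof.
have -> : (i + b + (k + a) = (a + b) + (i + k))%N by lia.
have -> : 'C((k + a).+1, k) = 'C(a.+1 + k, k) by rewrite addSn addnC.
have -> : 'C((k + a).+1, k.+1) = 'C(a + k.+1, k.+1) by rewrite addnS addnC.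
have -> : 'C((k + a).+2, k.+1) = 'C(a.+1 + k.+1, k.+1) by rewrite addSn addnS addnC.
rewrite !natrM !natr_bin.
have -> : ((k + a).+1 + (i + b) = (a + b + (i + k)).+1)%N by lia.
rewrite (addnC i k) !addSn !addnS (addnC a k) !factS !natrM.
have f0 n : n`!%:R != 0 :> rat by rewrite pnatr_eq0 -lt0n fact_gt0.
have s0 n : n.+1%:R != 0 :> rat by rewrite pnatr_eq0.
field.
by rewrite !f0 -!natrD !nat1r !s0.
Qed.

Theorem lemma2p3 (l m : nat) (hl : (1 <= l)%N) (hm : (1 <= m)%N) :
  (2 * l)%:R * (stirling1 (1 + m) (1 + l))%:~R
  = ((m + 1)%:R / (l + m - 1)%:R) *
    \sum_(1 <= n < l.+1) \sum_(0 <= k < m)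
      ('C(l + m - 2, n + k - 1)%:R^-1 * 'C(m, k)%:R * 'C(m, 1 + k)%:R
       * (stirling1 (1 + k) n)%:~R * (stirling1 (m - k) (l + 1 - n))%:~R)
  :> rat.
Proof.
case: l hl => // L _; case: m hm => // M _.
rewrite big_add1 /= big_mkord.
under eq_bigr => i _ do rewrite big_mkord.
(* The weight on the left of the convolution without the factor [L + 1 = l] of [L.+1!], which
   becomes the [l] of [2l]. *)
have w0 : ('C(M.+1 + L, L) * L`!)%:R != 0 :> rat.
  by rewrite pnatr_eq0 -lt0n muln_gt0 fact_gt0 bin_gt0 leq_addl.
apply: (mulIf w0).
have /(congr1 (fun x => (-1) ^+ (M + L) * x)) := rising_factorial_convolution M L.
rewrite mulr_sumr => conv.
transitivity ((-1) ^+ (M + L) *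
  (('C(M.+1 + L, L) * L.+1`!)%:R * ((rising_factorial M.+2)`_L.+2)%:~R *+ 2)
  : rat).
  rewrite stirling1E rmorphM rmorphXn rmorphN1 /= !add1n factS !natrM.
  rewrite !addSn !addnS !exprS -mulr_natr; ring.
rewrite conv mulr_sumr mulr_suml; apply: eq_bigr => i _.
rewrite !mulr_sumr mulr_suml; apply: eq_bigr => k _.
have [/= iL kM] := (ltn_ord i, ltn_ord k); rewrite !ltnS in iL kM.
have := binomial_weights k i (M - k) (L - i).
rewrite (subnKC iL) (subnKC kM) !stirling1E !rmorphM !rmorphXn !rmorphN1 /=.
rewrite addn1 !add1n (subSn kM).
have -> : (L.+1 + 1 - i.+1 = (L - i).+1)%N by lia.
have -> : (L.+1 + M.+1 - 1 = (L + M).+1)%N by lia.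
have -> : (L.+1 + M.+1 - 2 = L + M)%N by lia.
have -> : (i.+1 + k - 1 = i + k)%N by lia.
(* The exponents on the right add up to [M + L + 4], so every summand carries the same sign as the
   left side. *)
have -> : (-1) ^+ (M + L)
    = (-1) ^+ (k.+1 + i.+1) * (-1) ^+ ((M - k).+1 + (L - i).+1) :> rat.
  by rewrite -exprD -[LHS]signr_odd -[RHS]signr_odd; congr (_ ^+ _); lia.
set r := (X in _ = X -> _) => weights.
set c := (rising_factorial k.+1)`_i.+1.
set d := (rising_factorial (M - k).+1)`_(L - i).+1.
transitivity ((-1) ^+ (k.+1 + i.+1) * (-1) ^+ ((M - k).+1 + (L - i).+1)
  * c%:~R * d%:~R * r); first by rewrite /r; ring.
by rewrite -weights; ring.
Qed.
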